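(* Let $H=\{x\in\mathbb{C}: |x|\le 1,\ \operatorname{Im} x\ge 0\}$ be the closed upper half of the unit disk and let $\|\cdot\|_H$ denote the supremum norm on $H$. Let $\alpha$ be any positive real number. Then there exist a constant $A>0$ and rational functions $r_n$ of type $(n,n)$, $n=1,2,3,\dots$, such that, as $n\to\infty$, $$\|x^\alpha-r_n\|_H = O\left(e^{-A\sqrt n}\right).$$
   Context: A rational function of type $(n,n)$ is a quotient $p/q$ of polynomials $p,q$ with complex coefficients, each of degree at most $n$, with $q\not\equiv 0$. On $H$, $x^\alpha$ denotes the standard (principal) branch, $x^\alpha=|x|^\alpha e^{i\alpha\arg x}$ with $\arg x\in[0,\pi]$ for $x\neq 0$, and $0^\alpha=0$. The constant $A$ and the functions $r_n$ may depend on $\alpha$. *)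

(* Defs.v *)
From HB Require Import structures.
From mathcomp Require Export all_boot all_order all_algebra.
From mathcomp Require Export all_classical all_reals all_analysis.
From mathcomp Require Export complex.

Set Implicit Arguments.
Unset Strict Implicit.
Unset Printing Implicit Defensive.

Import Order.TTheory GRing.Theory Num.Theory.
Import ComplexField.Normc.
Local Open Scope classical_set_scope.
Local Open Scope ring_scope.
Local Open Scope complex_scope.

Definition upper_half_disk {R : realType} : set R[i] :=
  [set x | normc x <= 1 /\ 0 <= complex.Im x].

Definition expi (R : realType) (t : R) : R[i] := cos t +i* sin t.

(* The argument in [0, pi] of a nonzero x with Im x >= 0; for any other x
   the value is irrelevant ([upper_argP] and [upper_arg_polar] below show that
   it exists and is unique). *)
Definition upper_arg (R : realType) (x : R[i]) : R :=
  xget 0 [set t | 0 <= t <= pi /\ x = (normc x)%:C * expi t].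

(* |x|^alpha e^(i alpha arg x), arg x in [0, pi]; for alpha > 0 the value at
   0 is 0 because 0 `^ alpha = 0. *)
Definition upper_cpow (R : realType) (alpha : R) (x : R[i]) : R[i] :=
  (normc x `^ alpha)%:C * expi (alpha * upper_arg x).

(* [size p <= k.+1] says that p has degree at most k (or is 0). *)
Record ratfun (F : fieldType) (m n : nat) := Ratfun {
  ratnum : {poly F};
  ratden : {poly F};
  size_ratnum : (size ratnum <= m.+1)%N;
  size_ratden : (size ratden <= n.+1)%N;
  ratden_neq0 : ratden != 0 }.

(* By division by zero the value is 0 at the zeros of the denominator, hence
   [pole_free_on] below.  A common zero of [ratnum] and [ratden] also counts as
   a pole; common factors can be cancelled without leaving the type (m, n). *)
Definition rateval (F : fieldType) (m n : nat) (r : ratfun F m n) (x : F) : F :=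
  (ratnum r).[x] / (ratden r).[x].

Definition pole_free_on (F : fieldType) (m n : nat) (r : ratfun F m n)
    (D : set F) : Prop :=
  forall x, D x -> (ratden r).[x] != 0.

Definition sup_norm (R : realType) (D : set R[i]) (f : R[i] -> R[i]) : \bar R :=
  ereal_sup [set (normc (f x))%:E | x in D].

Lemma normc_expi (R : realType) (t : R) : normc (expi t) = 1.
Proof. by rewrite /expi /= cos2Dsin2 sqrtr1. Qed.

Lemma normc_polar (R : realType) (r t : R) :
  0 <= r -> normc (r%:C * expi t) = r.
Proof.
move=> r0; rewrite normcM normc_expi mulr1 /= expr0n /= addr0.
by rewrite sqrtr_sqr ger0_norm.
Qed.

Lemma upper_argP (R : realType) (x : R[i]) : 0 <= complex.Im x ->
  0 <= upper_arg x <= pi /\ x = (normc x)%:C * expi (upper_arg x).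
Proof.
case: x => a b /= b0; rewrite /upper_arg; case: xgetP => [t -> //|nex].
exfalso; set s := Num.sqrt (a ^+ 2 + b ^+ 2).
have ss : s ^+ 2 = a ^+ 2 + b ^+ 2 by rewrite sqr_sqrtr ?addr_ge0 ?sqr_ge0.
have s0 : 0 <= s by exact: sqrtr_ge0.
have [sz|sn0] := eqVneq s 0.
  have /eqP : a ^+ 2 + b ^+ 2 = 0 by rewrite -ss sz expr0n.
  rewrite paddr_eq0 ?sqr_ge0// !sqrf_eq0 => /andP[/eqP a0 /eqP bz].
  apply: (nex 0) => /=; rewrite lexx pi_ge0; split=> //.
  by rewrite -/s sz a0 bz /expi mul0r.
have sp : 0 < s by rewrite lt_neqAle eq_sym sn0.
have las : -1 <= a / s <= 1.
  rewrite -ler_norml normrM normfV (gtr0_norm sp) ler_pdivrMr// mul1r.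
  by rewrite -(@ler_pXn2r _ 2) ?nnegrE// real_normK ?num_real// ss lerDl sqr_ge0.
apply: (nex (acos (a / s))) => /=.
rewrite acos_ge0// acos_lepi//; split=> //.
rewrite -/s /expi acosK ?in_itv//= sin_acos//.
apply/eqP; rewrite eq_complex /= !mul0r subr0 addr0.
rewrite mulrC divfK ?eqxx//=.
have -> : 1 - (a / s) ^+ 2 = (b / s) ^+ 2.
  apply: (@mulIf _ (s ^+ 2)); first by rewrite sqrf_eq0.
  rewrite mulrBl mul1r !expr_div_n !divfK ?sqrf_eq0// ss.
  by rewrite addrAC subrr add0r.
by rewrite sqrtr_sqr ger0_norm ?divr_ge0// mulrC divfK.
Qed.

Lemma upper_arg_polar (R : realType) (r t : R) :
  0 < r -> 0 <= t <= pi -> upper_arg (r%:C * expi t) = t.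
Proof.
move=> r0 tpi.
have im : 0 <= complex.Im (r%:C * expi t).
  by rewrite /= mul0r addr0 mulr_ge0 ?(ltW r0)//; exact: sin_ge0_pi.
have [tpi'] := upper_argP im; rewrite normc_polar ?ltW//.
set u := upper_arg _ in tpi' *.
move=> /(congr1 (@complex.Re R)) /=; rewrite !mul0r !subr0.
move=> /(mulfI (lt0r_neq0 r0)) ct.
by apply: cos_inj; rewrite ?in_itv.
Qed.

Lemma upper_cpow_polar (R : realType) (alpha r t : R) :
  0 < r -> 0 <= t <= pi ->
  upper_cpow alpha (r%:C * expi t) = (r `^ alpha)%:C * expi (alpha * t).
Proof.
by move=> r0 tpi; rewrite /upper_cpow upper_arg_polar// normc_polar// ltW.
Qed.

Lemma upper_cpow0 (R : realType) (alpha : R) :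
  0 < alpha -> upper_cpow alpha 0 = 0 :> R[i].
Proof.
by move=> a0; rewrite /upper_cpow normc0 powR0 ?mul0r// gt_eqF.
Qed.

(* Main.v *)
Require Import Defs.
From mathcomp Require Import all_boot all_order all_algebra.
From mathcomp Require Import all_classical all_reals all_analysis.
From mathcomp Require Import complex.
From mathcomp Require Import ring lra zify.
Import Order.TTheory GRing.Theory Num.Theory.
Import numFieldNormedType.Exports.
Import ComplexField.Normc.
Local Open Scope classical_set_scope.
Local Open Scope ring_scope.
Set Implicit Arguments.
Unset Strict Implicit.
Unset Printing Implicit Defensive.

(* For Re z >= 0 and 0 < beta < 1, z^beta is up to a constant the integral of
   t^(beta-1) z / (t + z) over t > 0, and any fine Riemann sum S of it will do:
   the sums below nearly satisfy z S' = beta S, because the defect telescopes,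
   so that S(z) is close to z^beta S(1).  Each kernel z / (t + z) is replaced by
     z / (t + z) * (1 - phi(z) / phi(- t)),
   where phi = prod_a ((z - a) / (z + a))^s over a = e^-s, ..., e^s.  This has
   poles only at the 2s + 1 points - a, hence degree O(s^2) for the whole sum.
   On Re z >= 0 we have |phi(z)| <= 1, while 1 / phi(- t) is exponentially small
   in s for e^-s <= t <= e^s, and the mass of the sum outside this range is
   exponentially small as well; the mesh may be as fine as needed since it does
   not enter the degree.  The half disk is rotated into Re z >= 0 by z = - i x,
   and x^alpha = (x^(alpha / N))^N reduces to beta = alpha / N <= 1/2. *)

(** * The modulus on R[i] *)

Lemma normcD (R : realType) (x y : R[i]) : normc (x + y) <= normc x + normc y.
Proof. exact: le_normcD. Qed.

Lemma normcN (R : realType) (x : R[i]) : normc (- x) = normc x.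
Proof. by case: x => a b /=; rewrite !sqrrN. Qed.

Lemma normcB (R : realType) (x y : R[i]) : normc (x - y) <= normc x + normc y.
Proof. by rewrite -(normcN y); exact: normcD. Qed.

Lemma normc_ge0 (R : realType) (x : R[i]) : 0 <= normc x.
Proof. by case: x => a b; exact: sqrtr_ge0. Qed.

Lemma normc_sum (R : realType) (I : Type) (r : seq I) (P : pred I)
    (F : I -> R[i]) :
  normc (\sum_(i <- r | P i) F i) <= \sum_(i <- r | P i) normc (F i).
Proof.
elim/big_rec2: _ => [|i y x _ IH]; first by rewrite normc0.
by apply: le_trans (normcD _ _) _; rewrite lerD2l.
Qed.

Lemma normcX (R : realType) (x : R[i]) n : normc (x ^+ n) = normc x ^+ n.
Proof. by elim: n => [|n IH]; rewrite ?expr0 ?normc1// !exprS normcM IH. Qed.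

Lemma normc_prod (R : realType) (I : Type) (r : seq I) (P : pred I)
    (F : I -> R[i]) :
  normc (\prod_(i <- r | P i) F i) = \prod_(i <- r | P i) normc (F i).
Proof. by apply: big_morph; [exact: normcM | exact: normc1]. Qed.

Lemma sqr_normcE (R : realType) (z : R[i]) :
  normc z ^+ 2 = complex.Re z ^+ 2 + complex.Im z ^+ 2.
Proof. by case: z => a b /=; rewrite sqr_sqrtr// addr_ge0 ?sqr_ge0. Qed.

Lemma normc_real (R : realType) (x : R) : normc x%:C%C = `|x|.
Proof. by rewrite /= expr0n addr0 sqrtr_sqr. Qed.

Lemma normc_le_ReIm (R : realType) (z : R[i]) :
  normc z <= `|complex.Re z| + `|complex.Im z|.
Proof.
rewrite -(@ler_pXn2r _ 2) ?nnegrE ?normc_ge0 ?addr_ge0//.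
rewrite sqr_normcE sqrrD !real_normK ?num_real//.
by rewrite addrAC lerDl mulrn_wge0// mulr_ge0.
Qed.

Lemma Re_le_normc (R : realType) (z : R[i]) : `|complex.Re z| <= normc z.
Proof.
rewrite -(@ler_pXn2r _ 2) ?nnegrE ?normc_ge0//.
by rewrite sqr_normcE real_normK ?num_real// lerDl sqr_ge0.
Qed.

Lemma Im_le_normc (R : realType) (z : R[i]) : `|complex.Im z| <= normc z.
Proof.
rewrite -(@ler_pXn2r _ 2) ?nnegrE ?normc_ge0//.
by rewrite sqr_normcE real_normK ?num_real// lerDr sqr_ge0.
Qed.

Lemma normc_eq0 (R : realType) (z : R[i]) : (normc z == 0) = (z == 0).
Proof.
by apply/eqP/eqP => [/eq0_normc//|->]; exact: normc0.
Qed.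

Lemma normc_gt0 (R : realType) (z : R[i]) : (0 < normc z) = (z != 0).
Proof. by rewrite lt_neqAle normc_ge0 andbT eq_sym normc_eq0. Qed.

(** * Distances to points of the negative real axis *)

Section RightHalfPlane.
Variables (R : realType) (t : R) (z : R[i]).
Hypotheses (t0 : 0 <= t) (z0 : 0 <= complex.Re z).

Lemma ler_normc_shift : t <= normc (t%:C%C + z).
Proof.
case: z z0 => a b /= a0.
have ta := mulr_ge0 t0 a0; have b0 := sqr_ge0 b; have a2 := sqr_ge0 a.
rewrite -(@ler_pXn2r _ 2) ?nnegrE ?sqrtr_ge0// sqr_sqrtr ?addr_ge0 ?sqr_ge0//.
nra.
Qed.

Lemma normc_le_shift : normc z <= normc (t%:C%C + z).
Proof.
case: z z0 => a b /= a0.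
have ta := mulr_ge0 t0 a0; have b0 := sqr_ge0 b; have a2 := sqr_ge0 a.
rewrite ler_wsqrtr//; nra.
Qed.

(** The right half-plane lies on the side of the imaginary axis nearer to t than to - t. Taken over
    all factors of phi, this yields |phi(z)| <= 1. *)
Lemma normc_sub_le_shift : normc (z - t%:C%C) <= normc (t%:C%C + z).
Proof.
case: z z0 => a b /= a0.
have ta := mulr_ge0 t0 a0; have b0 := sqr_ge0 b; have a2 := sqr_ge0 a.
rewrite ler_wsqrtr//; nra.
Qed.

End RightHalfPlane.

(** * The complex exponential, and derivatives along a real parameter *)

Definition cexp (R : realType) (w : R[i]) : R[i] :=
  (expR (complex.Re w))%:C%C * expi (complex.Im w).

Lemma expiD (R : realType) (s t : R) : expi (s + t) = expi s * expi t.
Proof.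
by rewrite /expi cosD sinD; apply/eqP; rewrite eq_complex/= eqxx/= addrC mulrC
  [X in _ + X]mulrC addrC.
Qed.

Lemma cexpD (R : realType) (v w : R[i]) : cexp (v + w) = cexp v * cexp w.
Proof.
by rewrite /cexp raddfD raddfD/= expRD expiD rmorphM/= mulrACA.
Qed.

Lemma cexp0 (R : realType) : cexp 0 = 1 :> R[i].
Proof. by rewrite /cexp /= expR0 /expi cos0 sin0 mul1r. Qed.

Lemma normc_cexp (R : realType) (w : R[i]) : normc (cexp w) = expR (complex.Re w).
Proof. by rewrite /cexp normc_polar ?expR_ge0. Qed.

(** Componentwise derivative of a complex-valued function of a real variable: functions of z are
    only differentiated along paths. *)
Definition is_cderive (R : realType) (f : R -> R[i]) (s : R) (d : R[i]) :=
  is_derive s 1 (fun x => complex.Re (f x)) (complex.Re d) /\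
  is_derive s 1 (fun x => complex.Im (f x)) (complex.Im d).

Lemma is_cderive_eq (R : realType) (f : R -> R[i]) s d d' :
  is_cderive f s d -> d = d' -> is_cderive f s d'.
Proof. by move=> fd <-. Qed.

Lemma is_cderive_ext (R : realType) (f g : R -> R[i]) s d :
  f =1 g -> is_cderive f s d -> is_cderive g s d.
Proof. by move=> /funext ->. Qed.

Lemma is_cderive_cst (R : realType) (c : R[i]) s : is_cderive (fun=> c) s 0.
Proof. by split; exact: is_derive_cst. Qed.

Lemma is_cderiveD (R : realType) (f g : R -> R[i]) s d e :
  is_cderive f s d -> is_cderive g s e ->
  is_cderive (fun x => f x + g x) s (d + e).
Proof.
move=> [f1 f2] [g1 g2]; split; rewrite raddfD /=.
  rewrite (_ : (fun x => _) = (fun x => complex.Re (f x)) \+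
    (fun x => complex.Re (g x))); last by apply/funext => x; rewrite raddfD.
  exact: is_deriveD.
rewrite (_ : (fun x => _) = (fun x => complex.Im (f x)) \+
  (fun x => complex.Im (g x))); last by apply/funext => x; rewrite raddfD.
exact: is_deriveD.
Qed.

Lemma Re_mulc (R : realType) (x y : R[i]) : complex.Re (x * y) =
  complex.Re x * complex.Re y - complex.Im x * complex.Im y.
Proof. by case: x y => a b [c d]. Qed.

Lemma Im_mulc (R : realType) (x y : R[i]) : complex.Im (x * y) =
  complex.Re x * complex.Im y + complex.Im x * complex.Re y.
Proof. by case: x y => a b [c d]. Qed.

Lemma is_cderiveM (R : realType) (f g : R -> R[i]) s d e :
  is_cderive f s d -> is_cderive g s e ->
  is_cderive (fun x => f x * g x) s (d * g s + f s * e).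
Proof.
move=> [f1 f2] [g1 g2]; split; rewrite raddfD /=.
  rewrite (_ : (fun x => _) =
     (fun x => complex.Re (f x)) * (fun x => complex.Re (g x)) -
     (fun x => complex.Im (f x)) * (fun x => complex.Im (g x))); last first.
    by apply/funext => x; rewrite Re_mulc.
  apply: is_derive_eq; rewrite !Re_mulc /GRing.scale/=; ring.
rewrite (_ : (fun x => _) =
   (fun x => complex.Re (f x)) * (fun x => complex.Im (g x)) +
   (fun x => complex.Im (f x)) * (fun x => complex.Re (g x))); last first.
  by apply/funext => x; rewrite Im_mulc.
apply: is_derive_eq; rewrite !Im_mulc /GRing.scale/=; ring.
Qed.

Lemma is_cderiveV (R : realType) (f : R -> R[i]) s d :
  f s != 0 -> is_cderive f s d ->
  is_cderive (fun x => (f x)^-1) s (- d / f s ^+ 2).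
Proof.
move=> f0 [f1 f2].
pose u x := complex.Re (f x); pose v x := complex.Im (f x).
(* The sigma type keeps |f|^2 opaque, so that its derivative enters only through [dn] and [dnV]. *)
have [n nE'] : {n : R -> R | n = u ^+ 2 + v ^+ 2} by exists (u ^+ 2 + v ^+ 2).
have nE x : n x = u x ^+ 2 + v x ^+ 2 by rewrite nE'.
have n0 : n s != 0.
  by rewrite nE -sqr_normcE sqrf_eq0 normc_eq0.
have dn : is_derive s 1 n (2 * (u s * complex.Re d + v s * complex.Im d)).
  by rewrite nE'; apply: is_derive_eq; rewrite /GRing.scale/=; ring.
have dnV := is_deriveV n0 dn.
have fE : f s = (u s +i* v s)%C by rewrite /u /v; case: (f s).
have n0' := n0; rewrite nE in n0'.
have ninv : f s ^- 2 = ((u s ^+ 2 - v s ^+ 2) / n s ^+ 2 +i*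
    (- (2 * u s * v s) / n s ^+ 2))%C.
  apply: (@mulfI _ (f s ^+ 2)); first by rewrite sqrf_eq0.
  rewrite divff ?sqrf_eq0// fE expr2; apply/eqP; rewrite eq_complex/=.
  by rewrite nE; apply/andP; split; apply/eqP; field.
split.
  rewrite (_ : (fun x => _) = u * (fun x => (n x)^-1)); last first.
    apply/funext => x; transitivity (u x * (n x)^-1) => //.
    by rewrite nE /u /v; case: (f x).
  apply: is_derive_eq.
  rewrite Re_mulc ninv/= !raddfN /GRing.scale/= nE.
  by move: (complex.Re d) (complex.Im d) => ? ?; field.
rewrite (_ : (fun x => _) = - (v * (fun x => (n x)^-1))); last first.
  apply/funext => x; transitivity (- (v x * (n x)^-1)) => //.
  by rewrite nE /u /v; case: (f x).
apply: is_derive_eq.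
rewrite Im_mulc ninv/= !raddfN /GRing.scale/= nE.
by move: (complex.Re d) (complex.Im d) => ? ?; field.
Qed.

Lemma is_cderive_sum (R : realType) n (f : nat -> R -> R[i]) s (d : nat -> R[i]) :
  (forall j, is_cderive (f j) s (d j)) ->
  is_cderive (fun x => \sum_(j < n) f j x) s (\sum_(j < n) d j).
Proof.
move=> fd; elim: n => [|n IH].
  rewrite big_ord0; apply: is_cderive_ext (is_cderive_cst 0 s) => x.
  by rewrite big_ord0.
rewrite big_ord_recr/=; apply: is_cderive_ext (is_cderiveD IH (fd n)) => x.
by rewrite big_ord_recr.
Qed.

Lemma is_cderive_cexp (R : realType) (v w : R[i]) (s : R) :
  is_cderive (fun x => cexp (v + x%:C%C * w)) s (w * cexp (v + s%:C%C * w)).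
Proof.
case: v w => v1 v2 [w1 w2]; split.
  rewrite (_ : (fun x => _) = (fun x => expR (v1 + x * w1) * cos (v2 + x * w2)));
    last first.
    by apply/funext => x; rewrite /cexp/= !mul0r !subr0 addr0.
  have d1 : is_derive s 1 (fun x => v1 + x * w1) w1.
    by apply: is_derive_eq; rewrite /GRing.scale/=; ring.
  have d2 : is_derive s 1 (fun x => v2 + x * w2) w2.
    by apply: is_derive_eq; rewrite /GRing.scale/=; ring.
  have := @is_derive1_comp _ expR (fun x => v1 + x * w1) _ _ _
    (is_derive_expR (v1 + s * w1)) d1.
  have := @is_derive1_comp _ cos (fun x => v2 + x * w2) _ _ _
    (is_derive_cos (v2 + s * w2)) d2.
  rewrite /comp => dc de.
  apply: is_derive_eq; rewrite /GRing.scale/= !mul0r !subr0 !addr0; ring.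
rewrite (_ : (fun x => _) = (fun x => expR (v1 + x * w1) * sin (v2 + x * w2)));
  last first.
  by apply/funext => x; rewrite /cexp/= !mul0r !subr0 !addr0.
have d1 : is_derive s 1 (fun x => v1 + x * w1) w1.
  by apply: is_derive_eq; rewrite /GRing.scale/=; ring.
have d2 : is_derive s 1 (fun x => v2 + x * w2) w2.
  by apply: is_derive_eq; rewrite /GRing.scale/=; ring.
have := @is_derive1_comp _ expR (fun x => v1 + x * w1) _ _ _
    (is_derive_expR (v1 + s * w1)) d1.
have := @is_derive1_comp _ sin (fun x => v2 + x * w2) _ _ _
    (is_derive_sin (v2 + s * w2)) d2.
rewrite /comp => dc de.
apply: is_derive_eq; rewrite /GRing.scale/= !mul0r !subr0 !addr0; ring.
Qed.

(** * Mean value inequalities *)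

(** Both g + f and g - f have a nonnegative derivative, hence do not decrease from 0 to 1. *)
Lemma real_variation_le (R : realType) (f df g dg : R -> R) :
  (forall s : R, 0 <= s <= 1 -> is_derive s 1 f (df s)) ->
  (forall s : R, 0 <= s <= 1 -> is_derive s 1 g (dg s)) ->
  (forall s : R, 0 <= s <= 1 -> `|df s| <= dg s) ->
  `|f 1 - f 0| <= g 1 - g 0.
Proof.
move=> fd gd fg.
have mono (k dk : R -> R) : (forall s : R, 0 <= s <= 1 -> is_derive s 1 k (dk s)) ->
    (forall s : R, 0 <= s <= 1 -> 0 <= dk s) -> k 0 <= k 1.
  move=> kd dk0.
  have [] := @MVT_segment R k dk 0 1 ler01.
  - move=> x /[!in_itv]/= /andP[x0 x1].
    by apply: kd; rewrite !ltW.
  - apply: derivable_within_continuous => x /[!in_itv]/= x01.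
    by have [] := kd _ x01.
  move=> c /[!in_itv]/= /dk0 dkc; rewrite subr0 mulr1 => E.
  by rewrite -subr_ge0 E.
rewrite ler_norml; apply/andP; split.
  suff : (g + f) 0 <= (g + f) 1 by rewrite !fctE; lra.
  apply: (mono _ (fun s => dg s + df s)) => s s01.
    by have := fd _ s01; have := gd _ s01 => ? ?; exact: is_deriveD.
  by have := fg _ s01; rewrite ler_norml => /andP[]; lra.
suff : (g - f) 0 <= (g - f) 1 by rewrite !fctE; lra.
apply: (mono _ (fun s => dg s - df s)) => s s01.
  by have := fd _ s01; have := gd _ s01 => ? ?; exact: is_deriveB.
by have := fg _ s01; rewrite ler_norml => /andP[]; lra.
Qed.

(** The factor 2 is the price of treating real and imaginary parts separately. *)
Lemma complex_variation_le (R : realType) (f df : R -> R[i]) (g dg : R -> R) :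
  (forall s : R, 0 <= s <= 1 -> is_cderive f s (df s)) ->
  (forall s : R, 0 <= s <= 1 -> is_derive s 1 g (dg s)) ->
  (forall s : R, 0 <= s <= 1 -> normc (df s) <= dg s) ->
  normc (f 1 - f 0) <= 2 * (g 1 - g 0).
Proof.
move=> fd gd fg; apply: le_trans (normc_le_ReIm _) _.
rewrite !raddfB/= mulr2n mulrDl mul1r; apply: lerD.
  apply: (@real_variation_le _ (fun x => complex.Re (f x))
    (fun x => complex.Re (df x)) _ dg) => // s s01.
    by have [] := fd _ s01.
  exact: le_trans (Re_le_normc _) (fg _ s01).
apply: (@real_variation_le _ (fun x => complex.Im (f x))
  (fun x => complex.Im (df x)) _ dg) => // s s01.
  by have [] := fd _ s01.
exact: le_trans (Im_le_normc _) (fg _ s01).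
Qed.

(** * The Riemann sum and its defect in the equation z S' = beta S *)

Section StieltjesSum.
Variables (R : realType) (p h : R) (M : nat).
Hypotheses (p4 : 4 <= p) (h0 : 0 < h) (ph : p * h <= 2^-1).

Local Notation beta := (2 / p).
Local Notation lam := (expR h).
Local Notation q := (expR (p * h)).

(* The nodes of the Riemann sum are t_j = exp (p * mesh j), j < 2M, and
   beta = 2 / p, so that t_j ^ beta = exp (mesh j) ^+ 2. *)
Definition mesh (j : nat) : R := (j%:R - M%:R) * h.
Local Notation y := (fun j => expR (mesh j)).
Local Notation t := (fun j => expR (p * mesh j)).

(** The weight (lam^2 - 1) y_j^2 is the increment y_(j+1)^2 - y_j^2 of t^beta, so this is a
    Riemann-Stieltjes sum for the integral of z / (t + z) with respect to t^beta. *)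
Definition stieltjes_sum (z : R[i]) : R[i] := \sum_(j < M + M)
  ((lam ^+ 2 - 1) * y j ^+ 2)%:C%C * (z / ((t j)%:C%C + z)).

(* [z d/dz] of [stieltjes_sum]. *)
Definition stieltjes_euler (z : R[i]) : R[i] := \sum_(j < M + M)
  ((lam ^+ 2 - 1) * y j ^+ 2)%:C%C * (z * (t j)%:C%C / ((t j)%:C%C + z) ^+ 2).

Lemma exponent_gt0 : 0 < p. Proof. exact: lt_le_trans p4. Qed.

Lemma mesh_step_le8 : h <= 8^-1.
Proof.
have [[h0' ph'] p4'] := (h0, ph, p4).
have : 4 * h <= 2^-1 by apply: le_trans ph; rewrite ler_pM2r.
lra.
Qed.

(** From exp (- x) >= 1 - x one gets exp x <= 1 / (1 - x), and (1 - x) (1 + x + 2 x^2) = 1 + x^2 (1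
    - 2 x) >= 1 on [0, 1/2]. *)
Lemma expR_le_quadratic (x : R) : 0 <= x -> x <= 2^-1 ->
  expR x <= 1 + x + 2 * x ^+ 2.
Proof.
move=> x0 x2; have := expR_ge1Dx (- x); rewrite expRN => xe.
have e0 := expR_gt0 x.
have : (1 - x) * expR x <= 1 by rewrite -ler_pdivlMr// div1r.
nra.
Qed.

Lemma expR_step_ge : 1 + h <= lam. Proof. exact: expR_ge1Dx. Qed.

Lemma expR_step_le2 : lam <= 2.
Proof.
have [[h0' ph'] p4'] := (h0, ph, p4).
have h8 := mesh_step_le8.
have : lam <= 1 + h + 2 * h ^+ 2 by apply: expR_le_quadratic; lra.
nra.
Qed.

Lemma mesh_y j : y j.+1 = lam * y j.
Proof. by rewrite -expRD /mesh -natr1; congr expR; ring. Qed.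

Lemma mesh_t j : t j.+1 = q * t j.
Proof. by rewrite -expRD /mesh -natr1; congr expR; ring. Qed.

(** Here m stands for |z / (t + z)| with t = exp (p u). With Y = exp u, the left side is m (Y^3 +
    Y). For u <= 0 this is at most 2 Y, for u > 0 at most 2 / Y, while Y / (1 + Y)^2 is at least exp
    (- |u|) / 4. The spare factor Y + 1/Y pays later for the boundary terms and for the damping. *)
Lemma weight_le (u m : R) : 0 <= m -> m <= 1 -> m * expR (p * u) <= 1 ->
  expR u ^+ 2 * m * (expR u + expR (- u)) <= 8 * (expR u / (1 + expR u) ^+ 2).
Proof.
move=> m0 m1 mt; rewrite expRN.
have Y0 := expR_gt0 u; have [u0|u0] := leP u 0.
  have Y1 : expR u <= 1 by rewrite -expR0 ler_expR.
  move: (expR u) Y0 Y1 => Y Y0 Y1.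
  rewrite mulrA ler_pdivlMr ?exprn_gt0 ?addr_gt0//.
  have -> : Y ^+ 2 * m * (Y + Y^-1) = m * (Y * (Y ^+ 2 + 1)).
    by field; rewrite gt_eqF.
  have e1 : m * (Y * (Y ^+ 2 + 1)) <= 2 * Y.
    rewrite -[2 * Y]mul1r; apply: ler_pM => //; last by nra.
    by rewrite mulr_ge0 ?addr_ge0 ?sqr_ge0// ltW.
  have -> : 8 * Y = 2 * Y * 4 by ring.
  apply: ler_pM => //; last by nra.
    by rewrite !mulr_ge0 ?addr_ge0 ?sqr_ge0// ltW.
  by rewrite sqr_ge0.
have Y1 : 1 <= expR u by rewrite -expR0 ler_expR ltW.
(* This is where p >= 4 enters: t = Y^p >= Y^4 for Y >= 1. *)
have Y4 : m * expR u ^+ 4 <= 1.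
  apply: le_trans mt; apply: ler_wpM2l => //.
  by rewrite -expRM_natl ler_expR ler_pM2r.
move: (expR u) Y0 Y1 Y4 => Y Y0 Y1 Y4.
rewrite mulrA ler_pdivlMr ?exprn_gt0 ?addr_gt0//.
have -> : Y ^+ 2 * m * (Y + Y^-1) = (m * Y ^+ 4) * ((Y ^+ 2 + 1) / Y ^+ 3).
  by field; rewrite gt_eqF.
have e1 : (m * Y ^+ 4) * ((Y ^+ 2 + 1) / Y ^+ 3) <= 2 / Y.
  rewrite -[2 / Y]mul1r; apply: ler_pM => //.
  - by rewrite mulr_ge0 ?exprn_ge0// ltW.
  - by rewrite divr_ge0 ?addr_ge0 ?sqr_ge0 ?exprn_ge0// ltW.
  - rewrite ler_pdivrMr ?exprn_gt0//.
    have -> : 2 / Y * Y ^+ 3 = 2 * Y ^+ 2 by field; rewrite gt_eqF.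
    nra.
have -> : 8 * Y = 2 / Y * (4 * Y ^+ 2) by field; rewrite gt_eqF.
apply: ler_pM => //; last by nra.
  by rewrite mulr_ge0 ?divr_ge0 ?addr_ge0 ?mulr_ge0 ?sqr_ge0 ?exprn_ge0// ltW.
by rewrite sqr_ge0.
Qed.

(* (lam - 1) y / (1 + y)^2 is dominated by a multiple of the increment of
   y / (1 + y). *)
Lemma mesh_weight_sum n :
  (lam - 1) * (\sum_(j < n) y j / (1 + y j) ^+ 2) <= lam.
Proof.
have [[h0' ph'] p4'] := (h0, ph, p4).
pose V j := y j / (1 + y j).
have V1 j : (0 <= V j) && (V j <= 1).
  rewrite /V; have := expR_gt0 (mesh j) => Y0.
  apply/andP; split; first by rewrite divr_ge0 ?addr_ge0 ?ltW.
  by rewrite ler_pdivrMr ?addr_gt0// mul1r lerDr.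
apply: (@le_trans _ _ (lam * (V n - V 0%N))); last first.
  rewrite -[leRHS]mulr1 ler_wpM2l ?expR_ge0//.
  by have := V1 n; have := V1 0%N; lra.
rewrite -telescope_sumr// big_mkord !mulr_sumr; apply: ler_sum => j _.
rewrite /V mesh_y; have Y0 := expR_gt0 (mesh j).
have l1 := expR_step_ge; move: (expR (mesh j)) Y0 lam l1 => Y Y0 l l1.
have l0 : 0 < l by lra.
have lY : 0 < 1 + l * Y by rewrite addr_gt0// mulr_gt0.
have Y1 : 0 < 1 + Y by rewrite addr_gt0.
have -> : l * (l * Y / (1 + l * Y) - Y / (1 + Y)) =
  (l - 1) * (Y / (1 + Y) * (l / (1 + l * Y))).
  by field; rewrite !gt_eqF.
apply: ler_wpM2l; first lra.
rewrite expr2 invfM [leLHS]mulrA; apply: ler_wpM2l.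
  by rewrite divr_ge0 ?ltW.
by rewrite ler_pdivlMr// [leLHS]mulrC ler_pdivrMr//; nra.
Qed.

(** The weighted mass of the sum is bounded independently of the number of nodes and of the step;
    this is why the mesh can be refined at no cost. *)
Lemma mesh_weighted_sum_le n (m : nat -> R) :
  (forall j, [/\ 0 <= m j, m j <= 1 & m j * t j <= 1]) ->
  (lam - 1) * (\sum_(j < n) y j ^+ 2 * m j * (y j + expR (- mesh j))) <= 8 * lam.
Proof.
have [[h0' ph'] p4'] := (h0, ph, p4).
move=> mP; apply: le_trans (ler_wpM2l _ (mesh_weight_sum n)); last by [].
rewrite mulrCA; apply: ler_wpM2l; first by have := expR_step_ge; lra.
by rewrite mulr_sumr; apply: ler_sum => j _; apply: weight_le; case: (mP j).
Qed.

(** Since beta p = 2, both lam^2 - 1 and beta (q - 1) equal 2 h up to O(p h^2), so their difference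
    is of second order. The other term carries (q - 1)^2 and is of second order by itself. *)
Lemma coefficient_defect_le :
  `|(lam ^+ 2 - 1) - beta * lam ^+ 2 * (q - 1)|
    + beta * lam ^+ 2 * (q - 1) ^+ 2 <= 32 * p * h ^+ 2.
Proof.
have [[h0' ph'] p4'] := (h0, ph, p4).
have h8 := mesh_step_le8; have p0 := exponent_gt0.
have e2E : lam ^+ 2 = expR (2 * h) by rewrite expRM_natl.
have e2g : 2 * h <= lam ^+ 2 - 1.
  by rewrite e2E; have := expR_ge1Dx (2 * h); lra.
have e2l : lam ^+ 2 - 1 <= 2 * h + 8 * h ^+ 2.
  rewrite e2E; have : expR (2 * h) <= 1 + 2 * h + 2 * (2 * h) ^+ 2.
    by apply: expR_le_quadratic; lra.
  by rewrite exprMn; lra.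
have qg : p * h <= q - 1 by have := expR_ge1Dx (p * h); lra.
have ph0 : 0 < p * h by rewrite mulr_gt0.
have ql : q - 1 <= p * h + 2 * (p * h) ^+ 2.
  have : q <= 1 + p * h + 2 * (p * h) ^+ 2.
    by apply: expR_le_quadratic => //; exact: ltW.
  lra.
pose X := beta * (q - 1).
have pX : q - 1 = p / 2 * X by rewrite /X; field; rewrite gt_eqF.
have Xg : 2 * h <= X.
  rewrite pX in qg; have : p * (2 * h) <= p * X by lra.
  by rewrite ler_pM2l.
have Xl : X <= 2 * h + 4 * p * h ^+ 2.
  rewrite pX in ql; have : p * X <= p * (2 * h + 4 * p * h ^+ 2) by nra.
  by rewrite ler_pM2l.
have -> : beta * lam ^+ 2 * (q - 1) = lam ^+ 2 * X by rewrite /X; ring.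
have -> : beta * lam ^+ 2 * (q - 1) ^+ 2 = lam ^+ 2 * X * (q - 1).
  by rewrite /X; ring.
have ph2 : p * h ^+ 2 <= 2^-1 * h by rewrite expr2 mulrA ler_wpM2r// ltW.
have X4 : X <= 4 * h by lra.
have q2 : q - 1 <= 2 * (p * h) by nra.
have h2 : h ^+ 2 <= 8^-1 * h by rewrite expr2 ler_wpM2r// ltW.
have h20 := sqr_ge0 h.
have hp2 : 4 * h ^+ 2 <= p * h ^+ 2 by rewrite ler_wpM2r.
move: (lam ^+ 2) e2g e2l => e e2g e2l {e2E}.
have q0 : 0 <= q - 1 by lra.
move: (q - 1) pX q2 q0 {qg ql} => k pX k2 k0.
have r3 : e * X * k <= 2 * (4 * h) * (2 * (p * h)).
  apply: ler_pM => //; [|apply: ler_pM => //]; [rewrite mulr_ge0//|..]; lra.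
have r2 : (e - 1) * X <= (3 * h) * (4 * h).
  by apply: ler_pM => //; lra.
have r20 : 0 <= (e - 1) * X by rewrite mulr_ge0; lra.
have r1 : `|e - 1 - e * X| <= 4 * p * h ^+ 2 + 12 * h ^+ 2.
  have -> : e - 1 - e * X = (e - 1 - X) - (e - 1) * X by ring.
  by rewrite ler_norml; apply/andP; split; nra.
nra.
Qed.

Section AtPoint.
Variable z : R[i].
Hypotheses (z0 : 0 <= complex.Re z) (z1 : normc z <= 1).

Local Notation tc := (fun j => (t j)%:C%C : R[i]).
Local Notation m := (fun j => normc (z / (tc j + z))).

Lemma shift_gt0 (s : R) : 0 < s -> 0 < normc (s%:C%C + z).
Proof. by move=> s0; exact: lt_le_trans s0 (ler_normc_shift (ltW s0) z0). Qed.

Lemma shift_neq0 (s : R) : 0 < s -> s%:C%C + z != 0.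
Proof. by move=> s0; rewrite -normc_gt0 shift_gt0. Qed.

Lemma stieltjes_kernel_le (s : R) : 0 < s ->
  [/\ 0 <= normc (z / (s%:C%C + z)), normc (z / (s%:C%C + z)) <= 1
    & normc (z / (s%:C%C + z)) * s <= 1].
Proof.
move=> s0; split; rewrite ?normc_ge0// normcM normcV.
  by rewrite ler_pdivrMr ?shift_gt0// mul1r normc_le_shift// ltW.
rewrite mulrAC ler_pdivrMr ?shift_gt0// mul1r.
apply: le_trans (ler_normc_shift (ltW s0) z0).
by rewrite ler_piMl// ltW.
Qed.

(* With b = z / (t + z), the weights are chosen so that summation by parts of
   t^beta b cancels the first-order terms of each summand exactly; boundary terms
   and an O(h^2) error per node remain. *)
Lemma stieltjes_euler_defect :
  normc (stieltjes_euler z - beta%:C%C * stieltjes_sum z) <=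
    16 * expR (- (M%:R * h)) + 512 * p * h.
Proof.
have [[h0' ph'] p4'] := (h0, ph, p4).
have p0 := exponent_gt0; have t0 j : 0 < t j by exact: expR_gt0.
have mP j : [/\ 0 <= m j, m j <= 1 & m j * t j <= 1] by exact: stieltjes_kernel_le.
have b1 : 0 <= beta <= 1.
  by rewrite divr_ge0 ?(ltW exponent_gt0)//= ler_pdivrMr// mul1r; lra.
(* [F] is t^beta z / (t + z) at the nodes. [E] is what remains of a summand of z S' - beta S after -
   beta times the increment of [F] is split off; the increments telescope. *)
pose F j := (y j ^+ 2)%:C%C * (z / (tc j + z)).
pose E j := (y j ^+ 2)%:C%C * (z / (tc j + z)) * (tc j / (tc j + z)) *
  ((lam ^+ 2 - 1)%:C%C - (beta * lam ^+ 2 * (q - 1))%:C%C *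
    ((tc j + z) / (q%:C%C * tc j + z))).
have tz j : tc j + z != 0 by exact: shift_neq0.
have qtz j : q%:C%C * tc j + z != 0.
  by rewrite -rmorphM/=; apply: shift_neq0; rewrite mulr_gt0 ?expR_gt0.
have termE j : ((lam ^+ 2 - 1) * y j ^+ 2)%:C%C * (z * tc j / (tc j + z) ^+ 2)
    - beta%:C%C * (((lam ^+ 2 - 1) * y j ^+ 2)%:C%C * (z / (tc j + z)))
    = - beta%:C%C * (F j.+1 - F j) + E j.
  rewrite /F /E mesh_y mesh_t !(rmorphM, rmorphB, rmorphXn, rmorph1)/=.
  have := tz j; have := qtz j.
    move: (tc j) ((y j)%:C%C) (q%:C%C) (lam%:C%C) (2%:C%C) (p^-1%:C%C).
    move=> T Y Q l b1' b2' Z1 Z2.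
  by field; rewrite Z1 Z2.
have -> : stieltjes_euler z - beta%:C%C * stieltjes_sum z =
    - beta%:C%C * (F (M + M)%N - F 0%N) + \sum_(j < M + M) E j.
  rewrite /stieltjes_euler /stieltjes_sum mulr_sumr -sumrB.
  rewrite -telescope_sumr// big_mkord mulr_sumr -big_split/=.
  by apply: eq_bigr => j _; exact: termE.
have FE j : normc (F j) = y j ^+ 2 * m j.
  by rewrite normcM normc_real ger0_norm ?sqr_ge0.
have Fle j : y j ^+ 2 * m j * (y j + expR (- mesh j)) <= 8.
  case: (mP j) => mj0 mj1 mj2; apply: le_trans (weight_le mj0 mj1 mj2) _.
  rewrite -[leRHS]mulr1 ler_wpM2l// ler_pdivrMr ?exprn_gt0 ?addr_gt0 ?expR_gt0//.
  by have := expR_gt0 (mesh j); nra.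
have ym0 j : 0 <= y j ^+ 2 * m j by rewrite mulr_ge0 ?sqr_ge0 ?normc_ge0.
(* At the end nodes y + 1/y is at least exp (M h), so [Fle] makes [F] exponentially small there. *)
have Fb j : `|mesh j| = M%:R * h -> normc (F j) <= 8 * expR (- (M%:R * h)).
  move=> mj; rewrite FE expRN -ler_pdivrMr ?invr_gt0 ?expR_gt0// invrK.
  apply: le_trans (Fle j); apply: ler_wpM2l => //.
  rewrite -mj; have [/ger0_norm->|/ltr0_norm->] := leP 0 (mesh j).
    by rewrite lerDl expR_ge0.
  by rewrite lerDr expR_ge0.
have Mh0 : 0 <= M%:R * h by rewrite mulr_ge0 ?ler0n// ltW.
have F0 : normc (F 0%N) <= 8 * expR (- (M%:R * h)).
  by apply: Fb; rewrite /mesh sub0r mulNr normrN ger0_norm.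
have F2 : normc (F (M + M)%N) <= 8 * expR (- (M%:R * h)).
  by apply: Fb; rewrite /mesh natrD addrK ger0_norm.
apply: le_trans (normcD _ _) _; apply: lerD.
  rewrite normcM normcN normc_real ger0_norm; last by case/andP: b1.
  apply: (@le_trans _ _ (1 * (normc (F (M + M)%N) + normc (F 0%N)))).
    apply: ler_pM => //; rewrite ?normc_ge0//; last exact: normcB.
    by case/andP: b1.
    by case/andP: b1.
  lra.
have Ele j : normc (E j) <= 32 * p * h ^+ 2 *
    (2^-1 * (y j ^+ 2 * m j * (y j + expR (- mesh j)))).
  (* Since (t + z) / (q t + z) = 1 - (q - 1) t / (q t + z), the coefficients become those of
     [coefficient_defect_le]. *)
  have -> : E j = F j * (tc j / (tc j + z)) *
     (((lam ^+ 2 - 1) - beta * lam ^+ 2 * (q - 1))%:C%C +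
      (beta * lam ^+ 2 * (q - 1) ^+ 2)%:C%C * (tc j / (q%:C%C * tc j + z))).
    rewrite /E /F !(rmorphM, rmorphB, rmorphXn, rmorph1)/=.
    have := tz j; have := qtz j.
    move: (tc j) ((y j)%:C%C) (q%:C%C) (lam%:C%C) (2%:C%C) (p^-1%:C%C).
    move=> T Y Q l b1' b2' Z1 Z2.
    by field; rewrite Z1 Z2.
  rewrite normcM [normc (F j * _)]normcM FE mulrC.
  have q1 : 1 <= q by rewrite -expR0 ler_expR mulr_ge0 ?ltW.
  have bk0 : 0 <= beta * lam ^+ 2 * (q - 1) ^+ 2.
    by rewrite (mulr_ge0 (mulr_ge0 _ (sqr_ge0 _)) (sqr_ge0 _))//; case/andP: b1.
  apply: ler_pM; rewrite ?mulr_ge0 ?sqr_ge0 ?normc_ge0//.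
    apply: le_trans coefficient_defect_le; apply: le_trans (normcD _ _) _.
    rewrite normc_real lerD2l normcM normc_real ger0_norm; last first.
      exact: bk0.
    rewrite -[leRHS]mulr1; apply: ler_wpM2l.
      exact: bk0.
    have qt0 : 0 < q * t j by rewrite mulr_gt0 ?expR_gt0.
    rewrite normcM normcV normc_real ger0_norm ?expR_ge0// -rmorphM/=.
    rewrite ler_pdivrMr ?shift_gt0// mul1r.
    apply: le_trans (ler_normc_shift (ltW qt0) z0).
    by rewrite ler_peMl ?expR_ge0.
  apply: (@le_trans _ _ (y j ^+ 2 * m j * 1)).
    apply: ler_wpM2l => //.
    rewrite normcM normcV normc_real ger0_norm ?expR_ge0//.
    rewrite ler_pdivrMr ?shift_gt0// mul1r.
    exact: (ler_normc_shift (ltW (t0 j)) z0).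
  (* The factor 1/2 is absorbed by y + 1/y >= 2. *)
  rewrite [leRHS]mulrCA ler_wpM2l// expRN.
  have := expR_gt0 (mesh j); move: (expR (mesh j)) => Y Y0.
  have := sqr_ge0 (Y - 1); have YV : Y * Y^-1 = 1 by rewrite divff// gt_eqF.
  have : 0 < Y^-1 by rewrite invr_gt0.
  nra.
apply: le_trans (normc_sum _ _ _) _.
apply: (@le_trans _ _ (\sum_(j < M + M) (32 * p * h ^+ 2 *
    (2^-1 * (y j ^+ 2 * m j * (y j + expR (- mesh j))))))).
  by apply: ler_sum => j _; exact: Ele.
rewrite -mulr_sumr -mulr_sumr.
have := mesh_weighted_sum_le (M + M) mP.
set s := \sum_(j < M + M) _ => sle.
have s0 : 0 <= s.
  apply: sumr_ge0 => j _; rewrite mulr_ge0 ?addr_ge0 ?expR_ge0//.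
have hs : h * s <= 16.
  apply: (@le_trans _ _ ((lam - 1) * s)).
    by apply: ler_wpM2r => //; have := expR_step_ge; lra.
  by have := expR_step_le2; lra.
have -> : 32 * p * h ^+ 2 * (2^-1 * s) = 16 * p * h * (h * s) by field.
have -> : 512 * p * h = 16 * p * h * 32 by ring.
apply: ler_wpM2l; last lra.
by rewrite !mulr_ge0// ltW.
Qed.

End AtPoint.
End StieltjesSum.

(** * From the small defect to the power function *)

(** In the coordinate w = log z the right half of the unit disk without 0 becomes a half-strip, on
    which z^beta is simply [cexp] of beta w. *)
Lemma cexp_right_half (R : realType) (w : R[i]) : complex.Re w <= 0 ->
  `|complex.Im w| <= pi / 2 ->
  0 <= complex.Re (cexp w) /\ normc (cexp w) <= 1.
Proof.
move=> a0 b1; split; last by rewrite normc_cexp -expR0 ler_expR.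
rewrite /cexp Re_mulc /= mul0r subr0 mulr_ge0 ?expR_ge0//.
by apply: cos_ge0_pihalf; rewrite -ler_norml.
Qed.

(** Along a path with Z' = w Z, the derivative in s is w times z d/dz. *)
Lemma is_cderive_stieltjes_sum (R : realType) (p h : R) M (Z : R -> R[i]) s w :
  0 <= complex.Re (Z s) -> is_cderive Z s (w * Z s) ->
  is_cderive (fun x => stieltjes_sum p h M (Z x)) s
    (w * stieltjes_euler p h M (Z s)).
Proof.
move=> Z0 dZ; rewrite /stieltjes_euler mulr_sumr.
pose c j : R[i] := ((expR h ^+ 2 - 1) * expR (mesh h M j) ^+ 2)%:C%C.
pose T j : R[i] := (expR (p * mesh h M j))%:C%C.
apply: (@is_cderive_sum _ _ (fun j x => c j * (Z x / (T j + Z x))) s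
  (fun j => w * (c j * (Z s * T j / (T j + Z s) ^+ 2)))) => j.
have TZ : T j + Z s != 0 by apply: shift_neq0 => //; exact: expR_gt0.
apply: is_cderive_eq.
  apply: is_cderiveM; first exact: is_cderive_cst.
  apply: is_cderiveM; first exact: dZ.
  apply: is_cderiveV => //.
  apply: is_cderiveD; [exact: is_cderive_cst | exact: dZ].
by move: TZ; move: (T j) (Z s) (c j) => T' z c' TZ; field.
Qed.

(** The function f(s) = exp (beta (1 - s) w) S(exp (s w)) joins the two quantities compared, and its
    derivative is w exp (beta (1 - s) w) times the defect z S' - beta S at exp (s w). Integrating
    the majorant gives 2 eps (p/2 + pi/2), and pi < 4. *)
Lemma stieltjes_sum_near_power (R : realType) (p h eps : R) M (w : R[i]) :
  4 <= p -> 0 <= eps ->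
  (forall z, 0 <= complex.Re z -> normc z <= 1 ->
    normc (stieltjes_euler p h M z - (2 / p)%:C%C * stieltjes_sum p h M z)
      <= eps) ->
  complex.Re w <= 0 -> `|complex.Im w| <= pi / 2 ->
  normc (stieltjes_sum p h M (cexp w) -
         cexp ((2 / p)%:C%C * w) * stieltjes_sum p h M 1) <= eps * (p + 4).
Proof.
move=> p4 e0 defect a0 b1.
have p0 : 0 < p by exact: lt_le_trans p4.
pose beta := 2 / p.
have beta0 : 0 < beta by rewrite divr_gt0.
set a := complex.Re w in a0; set b := complex.Im w in b1.
(* The summand 0 matches the form of [is_cderive_cexp]. *)
pose Z (s : R) := cexp (0 + s%:C%C * w).
have ZP (s : R) : 0 <= s <= 1 -> 0 <= complex.Re (Z s) /\ normc (Z s) <= 1.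
  move=> /andP[s0 s1]; apply: cexp_right_half.
    by rewrite add0r Re_mulc/= mul0r subr0 mulr_ge0_le0.
  rewrite add0r Im_mulc/= mul0r addr0 normrM ger0_norm//.
  by apply: le_trans b1; rewrite ler_piMl.
pose B (s : R) := cexp (beta%:C%C * w + s%:C%C * (- beta%:C%C * w)).
pose f (s : R) := B s * stieltjes_sum p h M (Z s).
pose df (s : R) := w * B s * (stieltjes_euler p h M (Z s) -
   beta%:C%C * stieltjes_sum p h M (Z s)).
pose k (s : R) := expR (beta * a + s * (- beta * a)).
(* [g] majorizes the variation of [f]; it stays bounded as Re w -> -oo, which
   eps * |w| would not. *)
pose g (s : R) := eps * (k s * (p / 2) + pi / 2 * s).
pose dg (s : R) := eps * (- a * k s + pi / 2).
have fd (s : R) : 0 <= s <= 1 -> is_cderive f s (df s).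
  move=> s01; apply: is_cderive_eq.
    apply: is_cderiveM; first exact: is_cderive_cexp.
    apply: (@is_cderive_stieltjes_sum _ p h M Z s w); first by case: (ZP _ s01).
    exact: is_cderive_cexp.
  by rewrite /df -/(B s); ring.
have gd (s : R) : 0 <= s <= 1 -> is_derive s 1 g (dg s).
  move=> _.
  have dl : is_derive s 1 (fun s : R => beta * a + s * (- beta * a)) (- beta * a).
    by apply: is_derive_eq; rewrite /GRing.scale/=; ring.
  have := @is_derive1_comp _ expR (fun s : R => beta * a + s * (- beta * a)) _ _ _
    (is_derive_expR _) dl.
  rewrite /comp -/k => dk.
  rewrite (_ : g = (fun s => eps * (k s * (p / 2) + pi / 2 * s)))//.
  apply: is_derive_eq; rewrite /GRing.scale/= /dg -/(k s) /beta.
  by move: (k s) => ?; field; rewrite gt_eqF.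
have Bk s : normc (B s) = k s.
  by rewrite /B normc_cexp raddfD/= !Re_mulc/= !mul0r !subr0 ?oppr0 ?mul0r ?subr0.
have k1 (s : R) : 0 <= s <= 1 -> k s <= 1.
  move=> /andP[s0 s1]; rewrite -expR0 ler_expR.
  have -> : beta * a + s * (- beta * a) = (beta * (1 - s)) * a by ring.
  by rewrite mulr_ge0_le0// mulr_ge0 ?subr_ge0// ltW.
have pi2 : 0 <= pi / 2 :> R by rewrite divr_ge0 ?pi_ge0.
have fg (s : R) : 0 <= s <= 1 -> normc (df s) <= dg s.
  move=> s01; rewrite /df normcM [normc (w * _)]normcM Bk /dg [leRHS]mulrC.
  have [z0 z1] := ZP _ s01.
  apply: ler_pM; rewrite ?mulr_ge0 ?normc_ge0 ?expR_ge0//; last exact: defect.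
  apply: (@le_trans _ _ ((- a + pi / 2) * k s)).
    rewrite ler_wpM2r ?expR_ge0//; apply: le_trans (normc_le_ReIm _) _.
    by rewrite -/a -/b (ler0_norm a0) lerD2l.
  by rewrite mulrDl lerD2l ler_piMr// k1.
have := complex_variation_le fd gd fg.
have -> : f 1 = stieltjes_sum p h M (cexp w).
  rewrite /f /B /Z rmorph1 !mul1r add0r.
  have -> : beta%:C%C * w + - beta%:C%C * w = 0 by ring.
  by rewrite cexp0 mul1r.
have -> : f 0 = cexp (beta%:C%C * w) * stieltjes_sum p h M 1.
  by rewrite /f /B /Z rmorph0 !mul0r !addr0 cexp0.
move=> /le_trans; apply.
rewrite /g -/(pi / 2) mulr0 addr0 mulr1 -mulrBr mulrCA; apply: ler_wpM2l => //.
have -> : k 1 = 1 by rewrite /k mul1r mulNr subrr expR0.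
have : 0 <= k 0 * (p / 2) by rewrite mulr_ge0 ?expR_ge0 ?divr_ge0// ltW.
have := @pihalf_lt2 R; lra.
Qed.

(** Dividing the sum by its value at 1 replaces the evaluation of the constant in the integral
    formula. The mass bound 192 is uniform in eps. *)
Lemma stieltjes_sum_power (R : realType) (p : R) : 4 <= p ->
  forall eps : R, 0 < eps -> exists (n : nat) (c u : nat -> R),
  [/\ forall j, 0 <= c j,
    forall w : R[i], complex.Re w <= 0 -> `|complex.Im w| <= pi / 2 ->
      normc (cexp ((2 / p)%:C%C * w) - \sum_(j < n) (c j)%:C%C *
        (cexp w / ((expR (p * u j))%:C%C + cexp w))) <= eps &
    forall m : nat -> R,
      (forall j, [/\ 0 <= m j, m j <= 1 & m j * expR (p * u j) <= 1]) ->
      \sum_(j < n) c j * m j * (expR (u j) + expR (- u j)) <= 192].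
Proof.
move=> p4 eps eps0.
have p0 : 0 < p by exact: lt_le_trans p4.
(* The defect is at most (16 + 512 p) h, [stieltjes_sum_near_power] multiplies it by p + 4, and 1 /
   S(1) <= 4. *)
pose D := 4 * ((16 + 512 * p) * (p + 4)).
have D0 : 0 < D.
  by rewrite /D; apply: mulr_gt0; [lra | apply: mulr_gt0; lra].
(* With step h = 1 / L and M = L^2, the mesh becomes finer and, as M h = L, longer at once; the
   truncation term exp (- M h) is then at most h. *)
pose L := (Num.trunc (2 * p + D / eps)).+1.
have LB : 2 * p + D / eps < L%:R by exact: truncnS_gt.
have De0 : 0 < D / eps by rewrite divr_gt0.
have L0 : 0 < L%:R :> R by rewrite ltr0n.
pose h : R := L%:R^-1.
have h0 : 0 < h by rewrite invr_gt0.
have ph : p * h <= 2^-1.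
  rewrite ler_pdivrMr// mulrC ler_pdivlMr//.
  by apply: le_trans (ltW LB); rewrite mulrC; lra.
have Dh : D * h <= eps.
  rewrite ler_pdivrMr// mulrC -ler_pdivrMr//.
  by apply: le_trans (ltW LB); lra.
pose M := (L * L)%N.
have Mh : M%:R * h = L%:R by rewrite /M natrM mulfK// gt_eqF.
have eL : expR (- (M%:R * h)) <= h.
  rewrite Mh expRN lef_pV2 ?posrE ?expR_gt0//.
  by have := expR_ge1Dx (L%:R : R); lra.
set e1 := (16 + 512 * p) * h.
have e10 : 0 <= e1 by apply: mulr_ge0; [lra | exact: ltW].
have defect z : 0 <= complex.Re z -> normc z <= 1 ->
    normc (stieltjes_euler p h M z - (2 / p)%:C%C * stieltjes_sum p h M z) <= e1.
  move=> z0 z1; apply: le_trans (stieltjes_euler_defect M p4 h0 ph z0 z1) _.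
  by rewrite /e1 [leRHS]mulrDl lerD2r ler_wpM2l.
pose lam : R := expR h.
have lam1 : 1 < lam by rewrite -expR0 ltr_expR.
have lam2 : lam <= 2 by exact: (expR_step_le2 p4 h0 ph).
have lc0 : 0 < lam ^+ 2 - 1 by rewrite subr_gt0 exprn_egt1.
pose a j := expR (mesh h M j) ^+ 2.
pose s1 := \sum_(j < M + M) (lam ^+ 2 - 1) * a j / (expR (p * mesh h M j) + 1).
have s1E : stieltjes_sum p h M 1 = s1%:C%C.
  rewrite /stieltjes_sum /s1 rmorph_sum/=; apply: eq_bigr => j _.
  by rewrite !(rmorphM, fmorphV, rmorphD, rmorph1)/= !mul1r.
(* On the lower half of the mesh t_j <= 1, so each term is at least half the increment of [a]. These
   telescope to (1 - exp (- 2 M h)) / 2 >= 3/8. *)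
have s1_ge : 4^-1 <= s1.
  apply: (@le_trans _ _ (\sum_(j < M) (2^-1 * (a j.+1 - a j)))).
    rewrite -mulr_sumr -(big_mkord xpredT (fun j => a j.+1 - a j)) telescope_sumr//.
    have -> : a M = 1 by rewrite /a /mesh subrr mul0r expR0 expr1n.
    have -> : a 0%N = expR (- (M%:R * h)) ^+ 2 by rewrite /a /mesh sub0r mulNr.
    have h2 : h <= 2^-1.
      by apply: le_trans ph; rewrite ler_peMl ?(ltW h0)//; lra.
    have := expR_gt0 (- (M%:R * h)); move: (expR _) eL => x xh x0.
    have : x ^+ 2 <= (2^-1) ^+ 2.
      by rewrite ler_pXn2r ?nnegrE//; [apply: le_trans xh _| exact: ltW].
    lra.
  rewrite /s1 big_split_ord/= -[leLHS]addr0; apply: lerD.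
    apply: ler_sum => j _; rewrite /= /a mesh_y exprMn.
    have -> : lam ^+ 2 * expR (mesh h M j) ^+ 2 - expR (mesh h M j) ^+ 2 =
      (lam ^+ 2 - 1) * expR (mesh h M j) ^+ 2 by ring.
    rewrite [leRHS]mulrC ler_wpM2r ?mulr_ge0 ?sqr_ge0 ?(ltW lc0)//.
    rewrite lef_pV2 ?posrE ?addr_gt0 ?expR_gt0//.
    suff : expR (p * mesh h M j) <= 1 by lra.
    rewrite -expR0 ler_expR mulr_ge0_le0 ?(ltW p0)// mulr_le0_ge0 ?(ltW h0)//.
    by rewrite subr_le0 ler_nat ltnW.
  apply: sumr_ge0 => j _; rewrite divr_ge0 ?addr_ge0 ?expR_ge0//.
  by rewrite mulr_ge0 ?sqr_ge0// ltW.
have s10 : 0 < s1 by apply: lt_le_trans s1_ge; rewrite invr_gt0.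
have s1V : s1^-1 <= 4 by rewrite -[4]invrK lef_pV2 ?posrE ?invr_gt0.
exists (M + M)%N, (fun j => (lam ^+ 2 - 1) * a j / s1), (mesh h M); split.
- move=> j; rewrite divr_ge0 ?(ltW s10)// mulr_ge0 ?sqr_ge0//; exact: ltW.
- move=> w a0 b1; have := stieltjes_sum_near_power p4 e10 defect a0 b1.
  rewrite s1E.
  have -> : \sum_(j < M + M) ((lam ^+ 2 - 1) * a j / s1)%:C%C *
        (cexp w / ((expR (p * mesh h M j))%:C%C + cexp w)) =
      stieltjes_sum p h M (cexp w) * s1^-1%:C%C.
    rewrite /stieltjes_sum mulr_suml; apply: eq_bigr => j _.
    by rewrite !rmorphM/=; ring.
  set S := stieltjes_sum _ _ _ _; set P := cexp _ => H.
  have -> : P - S * s1^-1%:C%C = - (S - P * s1%:C%C) * s1^-1%:C%C.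
    have s1C : s1%:C%C * s1^-1%:C%C = 1 :> R[i].
      by rewrite -rmorphM/= divff ?rmorph1// gt_eqF.
    by rewrite -[P in LHS]mulr1 -s1C; ring.
  rewrite normcM normcN normc_real ger0_norm ?invr_ge0 ?(ltW s10)//.
  apply: (@le_trans _ _ (e1 * (p + 4) * 4)).
    by apply: ler_pM; rewrite ?normc_ge0 ?invr_ge0 ?(ltW s10).
  apply: le_trans Dh; rewrite /e1 /D; lra.
move=> m mP.
have := mesh_weighted_sum_le p4 h0 ph (M + M) mP.
set W := \sum_(j < M + M) _ => HW.
have -> : \sum_(j < M + M) (lam ^+ 2 - 1) * a j / s1 * m j *
   (expR (mesh h M j) + expR (- mesh h M j)) = ((lam - 1) * W) * ((lam + 1) / s1).
  rewrite [RHS]mulrAC /W mulr_sumr; apply: eq_bigr => j _.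
  rewrite /a; move: (expR _) (expR _) => x y; field; rewrite gt_eqF//.
(* Here (lam - 1) W <= 8 lam <= 8 * 2, and (lam + 1) / S(1) <= 3 * 4. *)
apply: (@le_trans _ _ (8 * 2 * 12)); last lra.
have W0 : 0 <= W.
  apply: sumr_ge0 => j _; case: (mP j) => mj0 _ _.
  by rewrite mulr_ge0 ?addr_ge0 ?expR_ge0// mulr_ge0 ?sqr_ge0.
apply: ler_pM.
- by rewrite mulr_ge0// subr_ge0 ltW.
- by rewrite divr_ge0 ?(ltW s10)//; lra.
- by apply: le_trans HW _; rewrite ler_pM2l.
apply: (@le_trans _ _ (3 * 4)); last lra.
by apply: ler_pM; rewrite ?invr_ge0 ?(ltW s10)//; lra.
Qed.

(** * Moving the poles to 2 s + 1 points of multiplicity s *)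

Lemma size_prod_leq_deg (F : idomainType) (n d : nat) (f : nat -> {poly F}) :
  (forall i, (size (f i) <= d.+1)%N) -> (size (\prod_(i < n) f i)%R <= (n * d).+1)%N.
Proof.
move=> fd; elim: n => [|n IH]; first by rewrite big_ord0 size_poly1.
rewrite big_ord_recr/=; apply: leq_trans (size_polyMleq _ _) _.
rewrite -subn1 leq_subLR add1n; apply: leq_trans (leq_add IH (fd n)) _.
by rewrite mulSn addSn addnS addnC.
Qed.

Section ClusteredPoles.
Variables (R : realType) (s : nat).

(** The shift by s lets a natural index 0, ..., 2 s run over the exponents - s, ..., s. *)
Definition pole (a : nat) : R := expR (a%:R - s%:R).

Definition poles_poly : {poly R[i]} :=
  \prod_(a < s.*2.+1) ('X + (pole a)%:C%C%:P) ^+ s.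

Definition zeros_poly : {poly R[i]} :=
  \prod_(a < s.*2.+1) ('X - (pole a)%:C%C%:P) ^+ s.

Lemma pole_gt0 a : 0 < pole a. Proof. exact: expR_gt0. Qed.

Lemma horner_poles_poly z : poles_poly.[z] = \prod_(a < s.*2.+1) ((pole a)%:C%C + z) ^+ s.
Proof.
rewrite horner_prod; apply: eq_bigr => a _.
by rewrite horner_exp hornerD hornerX hornerC addrC.
Qed.

Lemma horner_zeros_poly z : zeros_poly.[z] = \prod_(a < s.*2.+1) (z - (pole a)%:C%C) ^+ s.
Proof.
rewrite horner_prod; apply: eq_bigr => a _.
by rewrite horner_exp hornerXsubC.
Qed.

Lemma size_poles_poly : (size poles_poly <= (s.*2.+1 * s).+1)%N.
Proof.
apply: (@size_prod_leq_deg _ _ s (fun a => ('X + (pole a)%:C%C%:P) ^+ s)) => a.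
by apply: leq_trans (size_poly_exp_leq _ _) _; rewrite size_XaddC mul1n.
Qed.

Lemma size_zeros_poly : (size zeros_poly <= (s.*2.+1 * s).+1)%N.
Proof.
apply: (@size_prod_leq_deg _ _ s (fun a => ('X - (pole a)%:C%C%:P) ^+ s)) => a.
by apply: leq_trans (size_poly_exp_leq _ _) _; rewrite size_XsubC mul1n.
Qed.

Lemma poles_poly_neq0 z : 0 <= complex.Re z -> poles_poly.[z] != 0.
Proof.
move=> z0; rewrite horner_poles_poly; apply/prodf_neq0 => a _.
by rewrite expf_neq0// shift_neq0// pole_gt0.
Qed.

Lemma zeros_le_poles z : 0 <= complex.Re z ->
  normc zeros_poly.[z] <= normc poles_poly.[z].
Proof.
move=> z0; rewrite horner_zeros_poly horner_poles_poly !normc_prod.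
apply: ler_prod => a _; rewrite normc_ge0 !normcX lerXn2r ?nnegrE ?normc_ge0//.
by apply: normc_sub_le_shift => //; exact/ltW/pole_gt0.
Qed.

Lemma zeros_poly_neg_neq0 t : 0 < t -> zeros_poly.[- t%:C%C] != 0.
Proof.
move=> t0; rewrite horner_zeros_poly; apply/prodf_neq0 => a _.
rewrite expf_neq0// -opprD oppr_eq0 -rmorphD/= -normc_eq0 normc_real.
by rewrite normr_eq0 gt_eqF// addr_gt0// pole_gt0.
Qed.

(* 1 / phi(- t), where phi = zeros_poly / poles_poly. *)
Definition damping (t : R) : R[i] := poles_poly.[- t%:C%C] / zeros_poly.[- t%:C%C].

Lemma normc_damping t : 0 < t -> normc (damping t) =
  \prod_(a < s.*2.+1) (`|t - pole a| / (t + pole a)) ^+ s.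
Proof.
move=> t0; rewrite /damping horner_poles_poly horner_zeros_poly -prodf_div normc_prod.
apply: eq_bigr => a _; rewrite -expr_div_n normcX; congr (_ ^+ s).
have -> : (pole a)%:C%C + - t%:C%C = (pole a - t)%:C%C by rewrite rmorphB.
have -> : - t%:C%C - (pole a)%:C%C = - (t + pole a)%:C%C by rewrite rmorphD opprD.
rewrite normcM normcV normcN !normc_real distrC.
by rewrite (@ger0_norm _ (t + pole a))// ltW// addr_gt0// pole_gt0.
Qed.

(** All factors of the product are at most 1. If |p u| > s, the right side is already at least 1.
    Otherwise some pole P satisfies P <= t <= 4 P, so its factor is at most 3/5 <= 1 - 1/p <= exp (-
    1/p), and it occurs s times. *)
Lemma damping_le (p u : R) : 4 <= p ->
  normc (damping (expR (p * u))) <= expR (- (s%:R / p)) * (expR u + expR (- u)).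
Proof.
move=> p4; have p0 : 0 < p by exact: lt_le_trans p4.
rewrite normc_damping ?expR_gt0//.
have F01 (a : nat) : 0 <= (`|expR (p * u) - pole a| / (expR (p * u) + pole a)) ^+ s <= 1.
  have e0 := expR_gt0 (p * u); have p0' := pole_gt0 a.
  have r0 : 0 <= `|expR (p * u) - pole a| / (expR (p * u) + pole a).
    by rewrite divr_ge0// ltW// addr_gt0.
  rewrite exprn_ge0//= exprn_ile1//.
  by rewrite ler_pdivrMr ?addr_gt0// mul1r ler_norml; apply/andP; split; lra.
have prod1 : \prod_(a < s.*2.+1)
    (`|expR (p * u) - pole a| / (expR (p * u) + pole a)) ^+ s <= 1.
  by apply: prodr_ile1 => a _; exact: F01.
have [us|us] := ltP (p * u) (- s%:R).
  apply: le_trans prod1 _; rewrite mulrDr -[leLHS]add0r lerD ?mulr_ge0 ?expR_ge0//.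
  rewrite -expRD -[leLHS]expR0 ler_expR -opprD oppr_ge0.
  by rewrite -lerBrDr sub0r ler_pdivrMr//; lra.
have [us'|us'] := ltP s%:R (p * u).
  apply: le_trans prod1 _; rewrite mulrDr -[leLHS]addr0 lerD ?mulr_ge0 ?expR_ge0//.
  rewrite -expRD -[leLHS]expR0 ler_expR addrC subr_ge0.
  by rewrite ler_pdivrMr//; lra.
have us0 : 0 <= p * u + s%:R by lra.
(* The nearest pole below t on the logarithmic scale, found by truncation. *)
have [a0 a0l a0g] : exists2 a : nat, a%:R <= p * u + s%:R & p * u + s%:R < a%:R + 1.
  by exists (Num.trunc (p * u + s%:R)); have := truncn_itv us0; rewrite -natr1 => /andP[].
have a0s : (a0 < s.*2.+1)%N.
  rewrite ltnS -(ler_nat R) -addnn natrD; apply: le_trans a0l _.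
  by rewrite lerD2r.
have pl : pole a0 <= expR (p * u) by rewrite ler_expR lerBlDr.
have pg : expR (p * u) <= 4 * pole a0.
  have e4 : expR 1 <= 4 :> R.
    have : expR (2^-1 : R) <= 2.
      have := expR_ge1Dx (- 2^-1 : R); rewrite expRN.
      have := expR_gt0 (2^-1 : R); move: (expR _) => x x0 xe.
      have : 2^-1 <= x^-1 by lra.
      by rewrite lef_pV2 ?posrE.
    have -> : expR 1 = expR (2^-1) ^+ 2 :> R by rewrite -expRM_natl divff.
    have := expR_gt0 (2^-1 : R); move: (expR _) => x x0 x2.
    by nra.
  apply: (@le_trans _ _ (expR 1 * pole a0)); last by rewrite ler_wpM2r ?expR_ge0.
  by rewrite -expRD ler_expR addrA lerBrDr ltW// [ltRHS]addrC.
have f35 : (`|expR (p * u) - pole a0| / (expR (p * u) + pole a0)) ^+ s <=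
    expR (- (s%:R / p)).
  have e0 := expR_gt0 (p * u); have p0' := pole_gt0 a0.
  have -> : - (s%:R / p) = s%:R * (- p^-1) by rewrite mulrN.
  rewrite expRM_natl; rewrite lerXn2r ?nnegrE ?expR_ge0 ?divr_ge0 ?addr_ge0 ?expR_ge0//.
  apply: (@le_trans _ _ (1 - p^-1)); last exact: expR_ge1Dx.
  rewrite ger0_norm ?subr_ge0//.
  have : p^-1 <= 4^-1 by rewrite lef_pV2 ?posrE.
  rewrite ler_pdivrMr ?addr_gt0//; nra.
rewrite (bigD1 (Ordinal a0s))//= -[leLHS]mulr1 -mulrA.
apply: ler_pM => //.
- by case/andP: (F01 a0).
- by rewrite mulr1; apply: prodr_ge0 => a _; case/andP: (F01 a).
rewrite mulr1; apply: (@le_trans _ _ 1).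
  by apply: prodr_ile1 => a _; exact: F01.
rewrite expRN; have := expR_gt0 u; move: (expR u) => Y Y0.
have YV : Y * Y^-1 = 1 by rewrite divff// gt_eqF.
have : 0 < Y^-1 by rewrite invr_gt0.
nra.
Qed.

(** The damping constant is chosen so that poles_poly - damping * zeros_poly vanishes at - t_j. The
    factor t_j + z therefore divides it exactly, and the lost degree makes room for the factor z.
    All terms share one denominator, so the degree does not depend on n. *)
Lemma damped_sum_rational n (c t : nat -> R) : (forall j, 0 < t j) ->
  exists N : {poly R[i]}, (size N <= (s.*2.+1 * s).+1)%N /\
  forall z, 0 <= complex.Re z -> N.[z] / poles_poly.[z] =
    \sum_(j < n) (c j)%:C%C * (z / ((t j)%:C%C + z)) *
      (1 - damping (t j) * (zeros_poly.[z] / poles_poly.[z])).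
Proof.
move=> t0.
pose G j := poles_poly - (damping (t j)) *: zeros_poly.
pose U j := G j %/ ('X - (- (t j)%:C%C)%:P).
have UG j : U j * ('X - (- (t j)%:C%C)%:P) = G j.
  apply: divpK; rewrite -root_factor_theorem /root hornerD hornerN hornerZ.
  by rewrite /damping divfK ?subrr// zeros_poly_neg_neq0.
have sU j : (size (U j) <= s.*2.+1 * s)%N.
  rewrite size_divp ?polyXsubC_eq0// size_XsubC/= leq_subLR add1n.
  apply: leq_trans (size_polyD _ _) _.
  rewrite geq_max size_poles_poly size_polyN.
  exact: leq_trans (size_scale_leq _ _) size_zeros_poly.
exists (\sum_(j < n) (c j)%:C%C *: ('X * U j)); split.
  apply: leq_trans (size_sum _ _ _) _; apply/bigmax_leqP => j _.
  apply: leq_trans (size_scale_leq _ _) _; apply: leq_trans (size_polyMleq _ _) _.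
  by rewrite size_polyX; exact: sU.
move=> z z0; rewrite horner_sum mulr_suml; apply: eq_bigr => j _.
have Q0 := poles_poly_neq0 z0.
have tz : (t j)%:C%C + z != 0 by exact: shift_neq0.
have : (U j).[z] * ((t j)%:C%C + z) =
    poles_poly.[z] - damping (t j) * zeros_poly.[z].
  have := congr1 (fun q => q.[z]) (UG j).
  by rewrite hornerM hornerXsubC opprK hornerD hornerN hornerZ [z + _]addrC.
move=> /(canRL (mulfK tz)) Uz.
rewrite hornerZ hornerM hornerX Uz.
move: (t j)%:C%C (c j)%:C%C (damping (t j)) (poles_poly.[z]) zeros_poly.[z] tz Q0
  => T C k q r tz q0.
by field; rewrite tz q0.
Qed.

(** The constant 193 is 1 + 192: the Riemann sum is taken within exp (- s / p) of the power, and the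
    damping terms add at most the mass 192 times exp (- s / p). The value at 0 is recorded apart
    because [cexp] never reaches 0. *)
Lemma rational_near_power (p : R) : 4 <= p ->
  exists N : {poly R[i]}, [/\ (size N <= (s.*2.+1 * s).+1)%N,
    N.[0] / poles_poly.[0] = 0 &
  forall w : R[i], complex.Re w <= 0 -> `|complex.Im w| <= pi / 2 ->
    normc (cexp ((2 / p)%:C%C * w) - N.[cexp w] / poles_poly.[cexp w])
      <= 193 * expR (- (s%:R / p))].
Proof.
move=> p4.
have [n [c [u [c0 capx cmass]]]] := stieltjes_sum_power p4 (expR_gt0 (- (s%:R / p))).
have t0 j : 0 < expR (p * u j) by exact: expR_gt0.
have [N [sN NE]] := damped_sum_rational n c t0.
exists N; split=> //.
  by rewrite NE// big1// => j _; rewrite mul0r mulr0 mul0r.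
move=> w a0 b1; have [z0 z1] := cexp_right_half a0 b1.
rewrite NE//; set z := cexp w in z0 z1 *.
set S := \sum_(j < n) (c j)%:C%C * (z / ((expR (p * u j))%:C%C + z)).
have -> : cexp ((2 / p)%:C%C * w) -
    \sum_(j < n) (c j)%:C%C * (z / ((expR (p * u j))%:C%C + z)) *
      (1 - damping (expR (p * u j)) * (zeros_poly.[z] / poles_poly.[z])) =
  (cexp ((2 / p)%:C%C * w) - S) +
    \sum_(j < n) (c j)%:C%C * (z / ((expR (p * u j))%:C%C + z)) *
      (damping (expR (p * u j)) * (zeros_poly.[z] / poles_poly.[z])).
  rewrite -addrA; congr (_ + _); rewrite /S -!sumrN -big_split/=.
  by apply: eq_bigr => j _; rewrite mulrBr mulr1 opprB addrC.
apply: le_trans (normcD _ _) _.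
have -> : 193 * expR (- (s%:R / p)) = expR (- (s%:R / p)) + 192 * expR (- (s%:R / p)).
  by rewrite -[X in X + _]mul1r -mulrDl -natr1 addrC.
apply: lerD; first exact: capx.
pose m j := normc (z / ((expR (p * u j))%:C%C + z)).
have mP j : [/\ 0 <= m j, m j <= 1 & m j * expR (p * u j) <= 1].
  exact: stieltjes_kernel_le.
apply: le_trans (normc_sum _ _ _) _.
apply: (@le_trans _ _ (\sum_(j < n) (c j * m j * (expR (u j) + expR (- u j))) *
   expR (- (s%:R / p)))).
  apply: ler_sum => j _.
  rewrite normcM [normc (_%:C%C * _)]normcM normc_real (ger0_norm (c0 j)) -/(m j).
  have [m0 _ _] := mP j; rewrite -[leRHS]mulrA ler_wpM2l ?mulr_ge0//.
  rewrite normcM [normc (zeros_poly.[z] / _)]normcM normcV [leLHS]mulrC -[leRHS]mul1r.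
  apply: ler_pM; rewrite ?normc_ge0 ?divr_ge0 ?normc_ge0//.
    by rewrite ler_pdivrMr ?normc_gt0 ?poles_poly_neq0// mul1r zeros_le_poles.
  by rewrite [leRHS]mulrC; exact: damping_le.
by rewrite -mulr_suml ler_wpM2r ?expR_ge0//; exact: cmass.
Qed.

End ClusteredPoles.

(** * Rotation to the upper half disk *)

Lemma cexpX (R : realType) (v : R[i]) n : cexp v ^+ n = cexp (n%:R * v).
Proof.
elim: n => [|n IH]; first by rewrite mul0r cexp0.
by rewrite exprS IH -cexpD -[in RHS]natr1 mulrDl mul1r addrC.
Qed.

(* A logarithm of - i x. *)
Definition ilog (R : realType) (x : R[i]) : R[i] :=
  (ln (normc x) +i* (upper_arg x - pi / 2))%C.

Section UpperHalfDisk.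
Variables (R : realType) (x : R[i]).
Hypotheses (xH : upper_half_disk x) (x0 : x != 0).

Lemma Re_ilog_le0 : complex.Re (ilog x) <= 0.
Proof. by apply: ln_le0; case: xH. Qed.

Lemma Im_ilog_le : `|complex.Im (ilog x)| <= pi / 2.
Proof.
have [/andP[t0 t1] _] := upper_argP xH.2.
by rewrite /= ler_norml; apply/andP; split; lra.
Qed.

Lemma cexp_ilog : cexp (ilog x) = (0 +i* -1)%C * x.
Proof.
have [_ {2}->] := upper_argP xH.2.
rewrite /cexp /ilog/= lnK ?posrE ?normc_gt0// expiD [RHS]mulrCA.
congr (_ * _); rewrite mulrC; congr (_ * _).
by rewrite /expi cosN sinN cos_pihalf sin_pihalf.
Qed.

(** The rotation by - i lowers the argument by pi / 2; the constant factor of modulus 1 restores it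
    after the power is taken. *)
Lemma upper_cpow_cexp (a : R) :
  upper_cpow a x = cexp (a%:C%C * ilog x) * expi (a * (pi / 2)).
Proof.
rewrite /upper_cpow /cexp Re_mulc Im_mulc /= !mul0r subr0 addr0 -mulrA -expiD.
rewrite -mulrDr subrK; congr (_%:C%C * _).
by rewrite /powR normc_eq0 (negbTE x0).
Qed.

End UpperHalfDisk.

(** Substituting - i x changes no degree, and the unimodular constant goes into the numerator
    without affecting the error. *)
Lemma upper_cpow_rational (R : realType) (p : R) (s : nat) : 4 <= p ->
  exists P Q : {poly R[i]}, [/\ (size P <= (s.*2.+1 * s).+1)%N,
    (size Q <= (s.*2.+1 * s).+1)%N &
  forall x, upper_half_disk x -> Q.[x] != 0 /\
    normc (upper_cpow (2 / p) x - P.[x] / Q.[x]) <= 193 * expR (- (s%:R / p))].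
Proof.
move=> p4; have [N [sN N0 Nx]] := rational_near_power s p4.
have p0 : 0 < p by exact: lt_le_trans p4.
pose rot : {poly R[i]} := (0 +i* -1)%C *: 'X.
have rot0 : (0 +i* -1)%C != 0 :> R[i].
  by rewrite eq_complex/= eqxx/= oppr_eq0 oner_eq0.
have srot : size rot = 2 by rewrite size_scale// size_polyX.
have rotE x : rot.[x] = (0 +i* -1)%C * x by rewrite hornerZ hornerX.
exists (expi (2 / p * (pi / 2)) *: (N \Po rot)), (poles_poly R s \Po rot); split.
- by apply: leq_trans (size_scale_leq _ _) _; rewrite size_comp_poly2.
- by rewrite size_comp_poly2// size_poles_poly.
move=> x xH; rewrite hornerZ !horner_comp rotE.
(* The point 0 has no logarithm; the power and the rational function both vanish there. *)
have [->|x0] := eqVneq x 0.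
  rewrite mulr0 poles_poly_neq0//; split=> //.
  rewrite upper_cpow0 ?divr_gt0// -mulrA N0 mulr0 subr0 normc0.
  by rewrite mulr_ge0 ?expR_ge0.
have w0 := Re_ilog_le0 xH; have w1 := Im_ilog_le xH.
rewrite -(cexp_ilog xH x0); split.
  by apply: poles_poly_neq0; case: (cexp_right_half w0 w1).
rewrite (upper_cpow_cexp x0) [cexp (_ * _) * _]mulrC -mulrA -mulrBr normcM normc_expi.
by rewrite mul1r; exact: Nx.
Qed.

(** * Integer powers and the choice of parameters *)

Lemma upper_cpow_le1 (R : realType) (a : R) (x : R[i]) : 0 <= a ->
  upper_half_disk x -> normc (upper_cpow a x) <= 1.
Proof.
move=> a0 [x1 _]; rewrite /upper_cpow normcM normc_expi mulr1 normc_real.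
rewrite ger0_norm ?powR_ge0//.
rewrite [leRHS](_ : 1 = 1 `^ a); last by rewrite powR1.
by apply: ge0_ler_powR; rewrite // nnegrE ?normc_ge0.
Qed.

(** Both sides use the same argument of x, so no change of branch can occur. At x = 0 it matters
    that N > 0. *)
Lemma upper_cpow_natmul (R : realType) (a : R) (N : nat) (x : R[i]) :
  0 < a -> (0 < N)%N -> upper_half_disk x ->
  upper_cpow (N%:R * a) x = upper_cpow a x ^+ N.
Proof.
move=> a0 N0 xH; have [->|x0] := eqVneq x 0.
  by rewrite !upper_cpow0 ?mulr_gt0 ?ltr0n// expr0n gtn_eqF.
have expiX t n : expi t ^+ n = expi (n%:R * t) :> R[i].
  elim: n => [|n IH]; first by rewrite mul0r /expi cos0 sin0.
  by rewrite exprS IH -expiD -[in RHS]natr1 mulrDl mul1r addrC.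
rewrite !(upper_cpow_cexp x0) exprMn cexpX expiX.
by rewrite rmorphM rmorph_nat/= !mulrA.
Qed.

(** The quotient of x^n - y^n by x - y has n terms of degree n - 1, each at most b^n because b >=
    1. *)
Lemma normc_subX_le (R : realType) (x y : R[i]) (b : R) n :
  normc x <= b -> normc y <= b -> 1 <= b ->
  normc (x ^+ n - y ^+ n) <= n%:R * b ^+ n * normc (x - y).
Proof.
move=> xb yb b1; have b0 : 0 <= b by exact: le_trans b1.
rewrite subrXX normcM mulrC ler_wpM2r ?normc_ge0//.
apply: le_trans (normc_sum _ _ _) _.
have -> : n%:R * b ^+ n = \sum_(i < n) b ^+ n.
  by rewrite sumr_const card_ord mulr_natl.
apply: ler_sum => i _; rewrite normcM !normcX.
apply: (@le_trans _ _ (b ^+ (n.-1 - i) * b ^+ i)).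
  by apply: ler_pM; rewrite ?exprn_ge0 ?normc_ge0// lerXn2r ?nnegrE ?normc_ge0.
rewrite -exprD ler_weXn2l//.
by case: n i => [[]//|n] i /=; rewrite subnK ?leqnSn// -ltnS.
Qed.

Theorem theorem1 (R : realType) (alpha : R) (alpha_gt0 : 0 < alpha) :
  exists (A : R) (r : forall n : nat, ratfun R[i] n n),
    0 < A /\
    exists K : R, \forall n \near \oo,
      pole_free_on (r n) upper_half_disk /\
      (sup_norm upper_half_disk
         (fun x => (upper_cpow alpha x - rateval (r n) x)%R)
       <= (K * expR (- A * Num.sqrt n%:R))%:E)%E.
Proof.
(* Then alpha = N beta with beta = alpha / N < 1/2, that is p = 2 / beta >= 4. *)
have [N Nn0 Nalpha] : exists2 N : nat, (0 < N)%N & 2 * alpha < N%:R.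
  by exists (Num.trunc (2 * alpha)).+1 => //; exact: truncnS_gt.
have N0 : 0 < N%:R :> R by rewrite ltr0n.
pose p := 2 * N%:R / alpha.
have p0 : 0 < p by rewrite divr_gt0// mulr_gt0.
have p4 : 4 <= p by rewrite ler_pdivlMr//; lra.
have alphaE : alpha = N%:R * (2 / p).
  by rewrite /p; field; rewrite !gt_eqF.
(* The rate exp (- s / p) for s close to sqrt n / (2 N). *)
pose A := (2 * N%:R * p)^-1.
have A0 : 0 < A by rewrite invr_gt0 (mulr_gt0 _ p0)// mulr_gt0.
(* N 194^N comes from taking N-th powers, as the approximant is bounded by 1 + 193. The factor exp
   (1 / p) pays for rounding s down by less than 1. *)
pose K := N%:R * 194 ^+ N * (193 * expR p^-1).
suff H n : exists r : ratfun R[i] n n, pole_free_on r upper_half_disk /\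
    forall x, upper_half_disk x ->
      normc (upper_cpow alpha x - rateval r x) <= K * expR (- A * Num.sqrt n%:R).
  exists A, (fun n => projT1 (cid (H n))); split=> //; exists K.
  apply: nearW => n; case: cid => r [rfree rle] /=; split=> //.
  by apply: ge_ereal_sup => _ [x xH <-]; rewrite lee_fin rle.
have q0 : 0 <= Num.sqrt n%:R / (2 * N%:R) :> R.
  by rewrite divr_ge0 ?sqrtr_ge0// mulr_ge0// ltW.
have [s sl sg] : exists2 s : nat, s%:R <= Num.sqrt n%:R / (2 * N%:R) :> R &
    Num.sqrt n%:R / (2 * N%:R) < s%:R + 1 :> R.
  move: q0; move: (_ / _) => x q0; exists (Num.trunc x).
    by have := truncn_itv q0 => /andP[].
  by have := truncn_itv q0; rewrite -natr1 => /andP[].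
have [P [Q [sP sQ PQ]]] := upper_cpow_rational s p4.
(* For s > 0, 2 s + 1 <= 4 s gives the bound (2 N s)^2 <= n on the degree of the N-th power; s = 0
   is trivial. *)
have degN : ((s.*2.+1 * s) * N <= n)%N.
  have sN : (s * (2 * N))%:R <= Num.sqrt n%:R :> R.
    by rewrite !natrM -ler_pdivlMr ?mulr_gt0.
  have sN2 : ((s * (2 * N)) ^ 2 <= n)%N.
    rewrite -(ler_nat R) natrX -[leRHS]sqr_sqrtr ?ler0n//.
    by rewrite lerXn2r ?nnegrE ?sqrtr_ge0.
  apply: leq_trans sN2.
  have -> : ((s * (2 * N)) ^ 2 = (4 * N * s * s) * N)%N.
    by rewrite -mulnn; ring.
  rewrite leq_mul2r; apply/orP; right; rewrite leq_mul2r.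
  have [->//|s0] := posnP s.
  rewrite /= -addnn.
  apply: (@leq_trans (4 * 1 * s)).
    by lia.
  by rewrite leq_mul2r leq_mul2l Nn0 !orbT.
have sX (F : {poly R[i]}) : (size F <= (s.*2.+1 * s).+1)%N -> (size (F ^+ N)%R <= n.+1)%N.
  move=> sF; apply: leq_trans (size_poly_exp_leq _ _) _; rewrite ltnS.
  apply: leq_trans degN; rewrite leq_mul2r; apply/orP; right.
  by rewrite -ltnS; case: (size F) sF.
have H0 : upper_half_disk (0 : R[i]) by split; rewrite ?normc0.
have Q0 : Q ^+ N != 0.
  rewrite expf_neq0//; apply: contraTneq isT => Qz.
  by have [] := PQ _ H0; rewrite Qz horner0 eqxx.
exists (Ratfun (sX _ sP) (sX _ sQ) Q0); split.
  by move=> x /PQ[Qx _] /=; rewrite horner_exp expf_neq0.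
move=> x xH; have [Qx PQx] := PQ _ xH.
rewrite /rateval/= !horner_exp -expr_div_n alphaE.
have b0 : 0 < 2 / p by rewrite divr_gt0.
rewrite upper_cpow_natmul//.
have f1 := upper_cpow_le1 (ltW b0) xH.
set f := upper_cpow _ x in f1 PQx *; set r := P.[x] / Q.[x] in PQx *.
have e1 : expR (- (s%:R / p)) <= 1.
  by rewrite -expR0 ler_expR oppr_le0 divr_ge0// ltW.
have r194 : normc r <= 194.
  have -> : r = f - (f - r) by rewrite subKr.
  apply: le_trans (normcB _ _) _; lra.
have f194 : normc f <= 194 by apply: le_trans f1 _; lra.
apply: le_trans (normc_subX_le N f194 r194 _) _; first lra.
rewrite /K -mulrA -[leRHS]mulrA -[leRHS]mulrA.
rewrite ler_wpM2l// ler_wpM2l ?exprn_ge0//.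
apply: le_trans PQx _; rewrite -[leRHS]mulrA ler_wpM2l// -expRD ler_expR.
have -> : - A * Num.sqrt n%:R = - (Num.sqrt n%:R / (2 * N%:R) / p).
  by rewrite /A; field; rewrite !gt_eqF.
rewrite -mulNr -[X in _ <= X + _]mul1r -mulNr -mulrDl ler_wpM2r ?invr_ge0 ?(ltW p0)//.
by lra.
Qed.
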